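(* Let $p$ be a prime, $S$ a finite $p$-group, $\mathcal{F}$ a constrained (saturated) fusion system on $S$, $M_{\mathcal{F}}$ the model for $\mathcal{F}$, and $\Lambda_{\mathcal{F}}$ the minimal $\mathcal{F}$-characteristic biset. Let ${}_S(M_{\mathcal{F}})_S$ be the set $M_{\mathcal{F}}$ regarded as an $(S,S)$-biset via left and right multiplication by elements of $S\le M_{\mathcal{F}}$. Then ${}_S(M_{\mathcal{F}})_S\cong\Lambda_{\mathcal{F}}$ as $(S,S)$-bisets.
   Context: Fusion systems and saturation are in the usual sense (Puig; Broto-Levi-Oliver). $\mathcal{F}(P,Q)$ denotes the set of $\mathcal{F}$-morphisms $P\to Q$ for $P,Q\le S$. $O_p(\mathcal{F})$ is the largest normal subgroup of $\mathcal{F}$: it is maximal among $N\trianglelefteq S$ such that every $\varphi\in\mathcal{F}(P,Q)$ extends to some $\widetilde\varphi\in\mathcal{F}(PN,QN)$ with $\widetilde\varphi(N)=N$. A saturated fusion system $\mathcal{F}$ on $S$ is constrained if $C_S(O_p(\mathcal{F}))\le O_p(\mathcal{F})$. A model for a constrained $\mathcal{F}$ is a finite group $M$ containing $S$ as a Sylow $p$-subgroup with $\mathcal{F}=\mathcal{F}_S(M)$ (the fusion system of $M$-conjugation among subgroups of $S$), $O_{p'}(M)=1$, and $C_M(O_p(M))\le O_p(M)$, where $O_p(M)$ and $O_{p'}(M)$ are the largest normal $p$- and $p'$-subgroups. It is known (Broto-Castellana-Grodal-Levi-Oliver) that every constrained fusion system has a model, unique up to isomorphism. All bisets are finite. An $(S,S)$-biset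 is a finite set $\Omega$ with a free left $S$-action and a free right $S$-action that commute; equivalently a left $(S\times S)$-set via $(b,a)\cdot\omega=b\cdot\omega\cdot a^{-1}$ on which $S\times 1$ and $1\times S$ act freely. For $P\le S$ and an injective homomorphism $\varphi\colon P\to S$, write $(P,\varphi)=\{(\varphi(a),a)\mid a\in P\}\le S\times S$. Every point-stabilizer in an $(S,S)$-biset has the form $(P,\varphi)$. $\Omega^{(P,\varphi)}$ denotes the set of points fixed by $(P,\varphi)$. $\Omega$ is $\mathcal{F}$-generated if every point-stabilizer is of the form $(P,\varphi)$ with $\varphi\in\mathcal{F}(P,S)$. $\Omega$ is $\mathcal{F}$-stable if for every $P\le S$, injective homomorphism $\varphi\colon P\to S$, and $\mathcal{F}$-isomorphisms $\eta_1\colon Q\to P$ and $\eta_2\colon\varphi(P)\to R$, one has $|\Omega^{(P,\varphi)}|=|\Omega^{(Q,\eta_2\varphi\eta_1)}|$. $\Omega$ is $\mathcal{F}$-characteristic if it is $\mathcal{F}$-generated, $\mathcal{F}$-stable, and $|\Omega|/|S|\not\equiv 0\pmod p$. Every saturated $\mathcal{F}$ has a unique (up to isomorphism) minimal $\mathcal{F}$-characteristic biset $\Lambda_{\mathcal{F}}$, meaning one that is, up to isomorphism, contained in every $\mathcal{F}$-characteristic biset. *)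

(* Defs.v *)
From HB Require Import structures.
From mathcomp Require Import all_boot all_fingroup all_solvable.

Set Implicit Arguments.
Unset Strict Implicit.
Unset Printing Implicit Defensive.

Import GroupScope.

(* A homomorphism P -> Q is encoded by a function gT -> gT of which only the
   restriction to P matters (fs_ext), so [fs_hom F P Q] stands for a set of
   maps P -> Q.  The objects are the subgroups of S; [fs_hom] takes sets so
   that it can be applied directly to an image f @: P or a product P * N, but
   its values on sets that are not groups are never used. *)
Record fusion_system (gT : finGroupType) (S : {group gT}) := FusionSystem {
  fs_hom : {set gT} -> {set gT} -> pred (gT -> gT);
  fs_ext : forall (P Q : {group gT}) (f g : gT -> gT),
    {in P, f =1 g} -> fs_hom P Q f -> fs_hom P Q g;
  fs_homP : forall (P Q : {group gT}) (f : gT -> gT), fs_hom P Q f ->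
    [/\ P \subset S, Q \subset S, {in P &, {morph f : x y / x * y}},
        {in P &, injective f} & f @: P \subset Q];
  fs_conj : forall (P Q : {group gT}) (x : gT), P \subset S -> Q \subset S ->
    x \in S -> P :^ x \subset Q -> fs_hom P Q (fun y => y ^ x);
  fs_comp : forall (P Q R : {group gT}) (f g : gT -> gT),
    fs_hom P Q f -> fs_hom Q R g -> fs_hom P R (g \o f);
  fs_corestr : forall (P Q : {group gT}) (f : gT -> gT),
    fs_hom P Q f -> fs_hom P (f @: P) f;
  fs_inv : forall (P Q : {group gT}) (f g : gT -> gT),
    fs_hom P Q f -> {in P, cancel f g} -> fs_hom (f @: P) P g
}.

Section Fusion.

Variables (gT : finGroupType) (S : {group gT}) (F : fusion_system S).
Implicit Types (A B N : {set gT}) (P Q : {group gT}) (f g : gT -> gT).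

Definition fs_iso A B f := fs_hom F A B f && (f @: A == B).

Definition fully_centralized A : Prop :=
  forall Q f, fs_iso A Q f -> #|'C_S(Q)| <= #|'C_S(A)|.

Definition fully_normalized A : Prop :=
  forall Q f, fs_iso A Q f -> #|'N_S(Q)| <= #|'N_S(A)|.

Definition fs_Aut A : {set {perm gT}} :=
  [set a in Aut A | fs_hom F A A a].

Definition S_Aut P : {set {perm gT}} := conj_aut P @: 'N_S(P).

(* N_f = {g in N_S(A) | f c_g f^-1 in Aut_S(f(A))}, with the second condition
   written as f c_g = c_h f on A for some h in N_S(f(A)). *)
Definition extender A f : {set gT} :=
  [set g in 'N_S(A) | [exists h in 'N_S(f @: A),
     [forall x in A, f (x ^ g) == f x ^ h]]].

Definition saturated (p : nat) : Prop :=
  (forall P, P \subset S -> fully_normalized P ->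
     fully_centralized P /\ p.-Sylow(fs_Aut P) (S_Aut P)) /\
  (forall P f, fs_hom F P S f -> fully_centralized (f @: P) ->
     exists2 g, fs_hom F (extender P f) S g & {in P, g =1 f}).

(* The set P * N is a subgroup since N is normal in S. *)
Definition fs_normal N : Prop :=
  N <| S /\
  forall P Q f, fs_hom F P Q f ->
    exists g, [/\ fs_hom F (P * N) (Q * N) g, {in P, g =1 f} & g @: N = N].

Definition is_fs_core (N : {group gT}) : Prop :=
  fs_normal N /\ forall N' : {group gT}, fs_normal N' -> N' \subset N.

Definition constrained : Prop :=
  exists2 N : {group gT}, is_fs_core N & 'C_S(N) \subset N.

End Fusion.

(* Conjugation is the right action y ^ x = x^-1 y x; as x ranges over the whole
   group M this gives the same maps as left conjugation. *)
Definition conj_hom (gT : finGroupType) (S M : {group gT})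
    (A B : {set gT}) (f : gT -> gT) : Prop :=
  [/\ A \subset S, B \subset S
    & exists2 x, x \in M & A :^ x \subset B /\ {in A, forall y, f y = y ^ x}].

Record is_model (gT : finGroupType) (S : {group gT}) (F : fusion_system S)
    (p : nat) (M : {group gT}) : Prop := IsModel {
  model_Sylow : p.-Sylow(M) S;
  model_fusion : forall (P Q : {group gT}) (f : gT -> gT),
    fs_hom F P Q f <-> conj_hom S M P Q f;
  model_pcore' : 'O_p^'(M) = 1;
  model_cent : 'C_M('O_p(M)) \subset 'O_p(M)
}.

(* The actions are functions on all of gT, of which only the values at
   elements of S matter. *)
Record biset (gT : finGroupType) (S : {group gT}) := Biset {
  bi_sort :> finType;
  bi_l : gT -> bi_sort -> bi_sort;
  bi_r : bi_sort -> gT -> bi_sort;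
  bi_l1 : forall w, bi_l 1 w = w;
  bi_lM : {in S &, forall a b w, bi_l (a * b) w = bi_l a (bi_l b w)};
  bi_r1 : forall w, bi_r w 1 = w;
  bi_rM : {in S &, forall a b w, bi_r w (a * b) = bi_r (bi_r w a) b};
  bi_lr : {in S &, forall a b w, bi_r (bi_l a w) b = bi_l a (bi_r w b)};
  bi_l_free : {in S, forall a w, bi_l a w = w -> a = 1};
  bi_r_free : {in S, forall a w, bi_r w a = w -> a = 1}
}.

Section Bisets.

Variables (gT : finGroupType) (S : {group gT}).
Implicit Types (O L : biset S) (A : {set gT}) (P Q R : {group gT}).

Definition biset_equivariant O L (h : O -> L) : Prop :=
  {in S, forall a w, h (bi_l a w) = bi_l a (h w)} /\
  {in S, forall a w, h (bi_r w a) = bi_r (h w) a}.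

Definition biset_iso O L : Prop :=
  exists2 h : O -> L, bijective h & biset_equivariant h.

Definition biset_embeds O L : Prop :=
  exists2 h : O -> L, injective h & biset_equivariant h.

Definition twisted_diag A (f : gT -> gT) : {set gT * gT} :=
  [set (f a, a) | a in A].

(* S x S acts on the left of O by (b, a) . w = b w a^-1. *)
Definition bi_stab O (w : O) : {set gT * gT} :=
  [set u in setX S S | bi_l u.1 (bi_r w u.2^-1) == w].

Definition bi_fix O (D : {set gT * gT}) : {set O} :=
  [set w : O | [forall u in D, bi_l u.1 (bi_r w u.2^-1) == w]].

Variable F : fusion_system S.

Definition fs_generated O : Prop :=
  forall w : O, exists P f, fs_hom F P S f /\ bi_stab w = twisted_diag P f.

Definition fs_stable O : Prop :=
  forall P (phi : {morphism P >-> gT}) Q R (eta1 eta2 : gT -> gT),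
    P \subset S -> 'injm phi -> phi @* P \subset S ->
    fs_iso F Q P eta1 -> fs_iso F (phi @* P) R eta2 ->
    #|bi_fix O (twisted_diag P phi)| =
    #|bi_fix O (twisted_diag Q (eta2 \o phi \o eta1))|.

Definition characteristic_biset (p : nat) O : Prop :=
  [/\ fs_generated O, fs_stable O & ~~ (p %| #|O| %/ #|S|)].

Definition minimal_characteristic_biset (p : nat) L : Prop :=
  characteristic_biset p L /\
  forall O, characteristic_biset p O -> biset_embeds L O.

End Bisets.

Section GroupBiset.

Variables (gT : finGroupType) (S M : {group gT}).
Hypothesis sSM : S \subset M.

Definition group_l (a : gT) (w : subg_of M) : subg_of M := subg M a * w.
Definition group_r (w : subg_of M) (a : gT) : subg_of M := w * subg M a.

Fact group_l1 w : group_l 1 w = w.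
Proof. by rewrite /group_l (morph1 (subg_morphism M)) mul1g. Qed.

Fact group_lM :
  {in S &, forall a b w, group_l (a * b) w = group_l a (group_l b w)}.
Proof.
by move=> a b Sa Sb w; rewrite /group_l subgM ?(subsetP sSM) // mulgA.
Qed.

Fact group_r1 w : group_r w 1 = w.
Proof. by rewrite /group_r (morph1 (subg_morphism M)) mulg1. Qed.

Fact group_rM :
  {in S &, forall a b w, group_r w (a * b) = group_r (group_r w a) b}.
Proof.
by move=> a b Sa Sb w; rewrite /group_r subgM ?(subsetP sSM) // mulgA.
Qed.

Fact group_lr :
  {in S &, forall a b w, group_r (group_l a w) b = group_l a (group_r w b)}.
Proof. by move=> a b _ _ w; rewrite /group_r /group_l mulgA. Qed.

Fact subg_eq1 a : a \in S -> subg M a = 1 -> a = 1.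
Proof.
by move=> Sa a1; rewrite -(subgK a (subsetP sSM a Sa)) a1.
Qed.

Fact group_l_free : {in S, forall a w, group_l a w = w -> a = 1}.
Proof.
move=> a Sa w aw; apply: subg_eq1 => //.
by apply: (mulIg w); rewrite mul1g.
Qed.

Fact group_r_free : {in S, forall a w, group_r w a = w -> a = 1}.
Proof.
move=> a Sa w aw; apply: subg_eq1 => //.
by apply: (mulgI w); rewrite mulg1.
Qed.

Definition group_biset : biset S :=
  Biset group_l1 group_lM group_r1 group_rM group_lr group_l_free group_r_free.

End GroupBiset.

(* Main.v *)
Require Import Defs.
From mathcomp Require Import all_boot all_fingroup all_solvable.

Set Implicit Arguments.
Unset Strict Implicit.
Unset Printing Implicit Defensive.

Import GroupScope.

(** The biset M is F-characteristic, so L embeds into it, say with image X.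
    Put Q = O_p(M).  The fixed points of (Q, c_x) in M form the coset x C_M(Q),
    and C_M(Q) <= Q <= S.  Stability of X under Aut_F(Q) = Aut_M(Q) makes the
    number of fixed points of (Q, c_x) in X independent of x in M; it is nonzero
    because X is nonempty, so X meets, and hence contains, every coset x C_M(Q). *)

Lemma mem_bi_fix (gT : finGroupType) (S : {group gT}) (O : biset S)
    (A : {set gT}) (f : gT -> gT) (w : O) :
  reflect {in A, forall a, bi_l (f a) (bi_r w a^-1) = w}
          (w \in bi_fix O (twisted_diag A f)).
Proof.
rewrite inE; apply: (iffP forall_inP) => [fixw a Aa | fixw _ /imsetP[a Aa ->]].
  exact/eqP/(fixw (f a, a))/imset_f.
exact/eqP/fixw.
Qed.

Section GroupBisetFix.

Variables (gT : finGroupType) (S M : {group gT}) (sSM : S \subset M).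

(** Solve b w a^-1 = w for b. The inverse of w appears because [a ^ x] means x^-1 a x, so left
    conjugation by w is [^ w^-1]. *)
Lemma group_biset_twist (a b : gT) (w : group_biset sSM) :
  a \in S -> b \in S ->
  (bi_l b (bi_r w a^-1) == w) = (b == a ^ (sgval w)^-1).
Proof.
move=> /(subsetP sSM) Ma /(subsetP sSM) Mb.
rewrite -(inj_eq subg_inj) /= !subgK ?groupV // conjgE invgK.
by rewrite (can2_eq (mulgK _) (mulgKV _)) invMg invgK mulgA.
Qed.

Lemma mem_group_biset_fix (A : {set gT}) (f : gT -> gT) (w : group_biset sSM) :
  A \subset S -> {in A, forall a, f a \in S} ->
  reflect {in A, forall a, f a = a ^ (sgval w)^-1}
          (w \in bi_fix (group_biset sSM) (twisted_diag A f)).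
Proof.
move=> /subsetP sAS fS; apply: (iffP (mem_bi_fix _ _ _)) => fixw a Aa.
  by apply/eqP; rewrite -(group_biset_twist w (sAS a Aa) (fS a Aa)) fixw.
by apply/eqP; rewrite (group_biset_twist w (sAS a Aa) (fS a Aa)) fixw.
Qed.

End GroupBisetFix.

Section Model.

Variables (gT : finGroupType) (p : nat) (S M : {group gT}).
Variables (F : fusion_system S) (modM : is_model F p M).

Let sSM : S \subset M := pHall_sub (model_Sylow modM).
Let MS : biset S := group_biset sSM.

(** The stabilizer of w is the graph of left conjugation by w on the largest subgroup of S that w
    conjugates into S, and this map lies in F because M realizes F. *)
Lemma model_biset_generated : fs_generated F MS.
Proof.
move=> w; exists (S :&: S :^ sgval w)%G, (fun a => a ^ (sgval w)^-1); split.
  apply/(model_fusion modM); split; rewrite ?subsetIl //.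
  exists (sgval w)^-1; first by rewrite groupV subgP.
  by split=> //; rewrite sub_conjgV subsetIr.
apply/setP=> -[b a]; rewrite !inE /=; apply/idP/imsetP.
  case/andP=> /andP[Sb Sa]; rewrite group_biset_twist // => /eqP def_b.
  by exists a; rewrite -?def_b // inE Sa mem_conjg -def_b.
case=> c /setIP[Sc]; rewrite mem_conjg => Swc [-> ->].
by rewrite Sc Swc group_biset_twist /=.
Qed.

(** The isomorphisms [eta1] and [eta2] are conjugations by some x and y in M, so the translation of
    M by y^-1 on the left and x^-1 on the right carries one fixed-point set onto the other. *)
Lemma model_biset_stable : fs_stable F MS.
Proof.
move=> P phi Q R eta1 eta2 sPS _ sphiS.
case/andP=> /(model_fusion modM)[sQS _ [x Mx [_ def1]]] /eqP im1.
case/andP=> /(model_fusion modM)[_ sRS [y My [_ def2]]] /eqP im2.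
have P1 b : b \in Q -> eta1 b \in P by move=> Qb; rewrite -im1; apply: imset_f.
have phiP a : a \in P -> phi a \in phi @* P by move=> Pa; rewrite mem_morphim.
have R2 b : b \in Q -> (eta2 \o phi \o eta1) b \in S.
  by move=> /P1/phiP Qb; apply: (subsetP sRS); rewrite -im2; apply: imset_f.
have phiS a : a \in P -> phi a \in S by move=> /phiP/(subsetP sphiS).
pose t (w : MS) : MS := subg M y^-1 * w * subg M x^-1.
have t_inj : injective t by move=> u v /mulIg/mulgI.
rewrite -(card_imset _ t_inj); apply: eq_card => v.
have [w ->] : exists w, v = t w.
  exists ((subg M y^-1)^-1 * v * (subg M x^-1)^-1).
  by rewrite /t !mulgA mulgV mul1g mulgKV.
rewrite mem_imset //; apply/mem_group_biset_fix/mem_group_biset_fix => // fixw.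
  move=> b Qb; rewrite /= def2 ?phiP ?P1 // fixw ?P1 // def1 //.
  by rewrite !subgK ?groupV // -!conjgM !invMg !invgK !mulgA.
(* The converse recovers [phi] on all of P, which is possible because [eta1] maps Q onto P. *)
move=> a Pa; have /imsetP[b Qb ->] : a \in eta1 @: Q by rewrite im1.
have:= fixw b Qb; rewrite /= def2 ?phiP ?P1 // => /(canRL (conjgK y)) ->.
by rewrite def1 // !subgK ?groupV // -!conjgM !invMg !invgK !mulgA mulgK.
Qed.

Lemma model_biset_characteristic : prime p -> characteristic_biset F p MS.
Proof.
move=> p_pr; split; [exact: model_biset_generated | exact: model_biset_stable |].
have [_ _] := and3P (model_Sylow modM).
rewrite (_ : #|MS| = #|M|); last by rewrite /= card_sub.
by rewrite divgS // p'natE.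
Qed.

Lemma model_biset_embed_surj (L : biset S) (h : L -> MS) :
  fs_stable F L -> #|L| > 0 -> injective h -> biset_equivariant h ->
  forall v, exists w, h w = v.
Proof.
move=> stabL /card_gt0P[w0 _] h_inj [hl hr] v.
set Q := 'O_p(M)%G.
have sQS : Q \subset S := pcore_sub_Hall (model_Sylow modM).
have nQM : M \subset 'N(Q) := gFnorm _ _.
have QJ m a : m \in M -> a \in Q -> a ^ m \in Q.
  by move=> Mm Qa; rewrite memJ_norm ?(subsetP nQM).
have conjQ m : m \in M -> fs_iso F Q Q (conjg^~ m).
  move=> Mm; have QmQ : Q :^ m = Q by apply: normP; rewrite (subsetP nQM).
  rewrite /fs_iso [_ @: _]QmQ eqxx andbT; apply/(model_fusion modM).
  by split=> //; exists m; rewrite ?QmQ.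
(* An injective equivariant map preserves and reflects fixed points, so those of L can be tested
   inside M. *)
have fixL (f : gT -> gT) w : {in Q, forall a, f a \in S} ->
    (w \in bi_fix L (twisted_diag Q f))
    = (h w \in bi_fix MS (twisted_diag Q f)).
  move=> fS; apply/mem_bi_fix/mem_bi_fix => fixw a Qa; last apply: h_inj.
    by rewrite -hr ?groupV ?(subsetP sQS) // -hl ?fS // fixw.
  by rewrite hl ?fS // hr ?groupV ?(subsetP sQS) // fixw.
pose x := sgval (h w0); pose y := sgval v.
have Mx : x \in M := subgP _.
have My : y \in M := subgP _.
have imQ : conjgm Q x^-1 @* Q = Q.
  by rewrite morphim_conj setIid; apply: normP; rewrite (subsetP nQM) ?groupV.
have M1 : 1 \in M := group1 M.
(* Conjugating by y^-1 x and then by x^-1 amounts to conjugating by y^-1. Stability thus compares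
   the fixed points for x, among them [w0], with those for y. *)
have Mt : y^-1 * x \in M by rewrite groupM ?groupV.
have eq_fix := stabL Q (conjgm Q x^-1) Q Q (conjg^~ (y^-1 * x)) (conjg^~ 1)
  sQS (injm_conj _ _).
rewrite imQ in eq_fix.
have {}eq_fix := eq_fix sQS (conjQ _ Mt) (conjQ _ M1).
have w0fix : w0 \in bi_fix L (twisted_diag Q (conjgm Q x^-1)).
  have QS a : a \in Q -> conjgm Q x^-1 a \in S.
    by move=> Qa; rewrite (subsetP sQS) //= QJ ?groupV.
  by rewrite fixL //; apply/mem_group_biset_fix.
have /card_gt0P[w] : 0 < #|bi_fix L (twisted_diag Q
    (conjg^~ 1 \o conjgm Q x^-1 \o conjg^~ (y^-1 * x)))|.
  by rewrite -eq_fix; apply/card_gt0P; exists w0.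
have QS a : a \in Q ->
    (conjg^~ 1 \o conjgm Q x^-1 \o conjg^~ (y^-1 * x)) a \in S.
  by move=> Qa; rewrite (subsetP sQS) //= !QJ ?groupV.
rewrite fixL // => /mem_group_biset_fix-/(_ sQS QS) /= fixw.
pose z := sgval (h w); have Mz : z \in M := subgP _.
(* Both z and y induce the same conjugation on Q, so z^-1 y centralizes Q and lies in Q by the model
   axiom. Since Q is in S, it can act on [w] from the right and move its image z to y. *)
have Qs : z^-1 * y \in Q.
  apply: (subsetP (model_cent modM)); rewrite inE groupM ?groupV //=.
  apply/centP=> a Qa; apply/commute_sym/commgP/conjg_fixP.
  by rewrite conjgM -fixw // conjg1 /conjgm -!conjgM !mulgA mulgK mulVg conjg1.
exists (bi_r w (z^-1 * y)); rewrite hr ?(subsetP sQS) //; apply: subg_inj.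
by rewrite /= subgK ?groupM ?groupV // mulKVg.
Qed.

End Model.

Theorem theoremB (gT : finGroupType) (p : nat) (S M : {group gT})
    (F : fusion_system S) (L : biset S)
    (p_pr : prime p) (pS : p.-group S)
    (satF : saturated F p) (conF : constrained F)
    (modM : is_model F p M)
    (minL : minimal_characteristic_biset F p L) :
  biset_iso (group_biset (pHall_sub (model_Sylow modM))) L.
Proof.
have [[_ stabL nzL] minimalL] := minL.
have [h h_inj eqh] := minimalL _ (model_biset_characteristic modM p_pr).
(* An empty biset would give the quotient 0, which p divides. *)
have L_gt0 : #|L| > 0.
  by rewrite lt0n; apply: contra nzL => /eqP->; rewrite div0n dvdn0.
have h_surj := model_biset_embed_surj stabL L_gt0 h_inj eqh.
have h_onto v : exists w, h w == v by have [w <-] := h_surj v; exists w.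
pose g v := xchoose (h_onto v).
have gK : cancel g h by move=> v; apply/eqP/(xchooseP (h_onto v)).
have hK : cancel h g by move=> w; apply: h_inj; rewrite gK.
exists g; first by exists h.
(* The inverse of [h] inherits equivariance: both sides agree after applying [h]. *)
by case: eqh => hl hr; split=> a Sa v; apply: h_inj; rewrite ?hl ?hr ?gK.
Qed.
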